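(* Let $m\ge 2$ and $n\ge m$ be integers, let $X_1,\ldots,X_n$ be i.i.d. random variables with values in a measurable space $\mathcal{X}$, and let $h:\mathcal{X}^m\to\mathbb{R}$ be measurable. Let $m_h=\mathrm{E}\,h(X_1,\ldots,X_m)$, let $U_n(h)$ be the U-statistic of order $m$ with kernel $h$, and let $k=\lfloor n/m\rfloor$. Suppose $h$ takes values in an interval of length $R>0$. Then for all $t>0$, $$P(U_n(h)-m_h\ge t)\le\exp\left(-\frac{2kt^2}{R^2}\right)\quad\text{and}\quad P(|U_n(h)-m_h|\ge t)\le 2\exp\left(-\frac{2kt^2}{R^2}\right).$$
   Context: The U-statistic of order $m$ with kernel $h$ based on $X_1,\ldots,X_n$ is $$U_n(h)=\frac{(n-m)!}{n!}\sum_{(i_1,\ldots,i_m)\in I_n^m}h(X_{i_1},\ldots,X_{i_m}),$$ where $I_n^m=\{(i_1,\ldots,i_m):1\le i_j\le n,\ i_j\ne i_l\text{ if }j\ne l\}$ is the set of all $m$-tuples of distinct integers between $1$ and $n$. The kernel $h$ is not assumed symmetric. *)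

(* Defs.v *)
From HB Require Import structures.
From mathcomp Require Import all_boot all_order all_algebra.
From mathcomp Require Import all_classical all_reals all_analysis.

Set Implicit Arguments.
Unset Strict Implicit.
Unset Printing Implicit Defensive.

Import Order.TTheory GRing.Theory Num.Theory.

Local Open Scope classical_set_scope.
Local Open Scope ring_scope.

(* [injective_tuples m n] is I_n^m; indices run over {0, ..., n - 1} instead of
   {1, ..., n}. *)
Definition injective_tuples (m n : nat) : {set m.-tuple 'I_n} :=
  [set i : m.-tuple 'I_n | uniq i]%SET.

Definition U_statistic (R : realType) (S : Type) (m n : nat)
    (h : m.-tuple S -> R) (x : 'I_n -> S) : R :=
  (n - m)`!%:R / n`!%:R *
  \sum_(i in injective_tuples m n) h [tuple x (tnth i j) | j < m].

Section iid.
Context (d d' : measure_display) (T : measurableType d) (S : measurableType d')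
  (R : realType) (P : probability T R) (n : nat).
Implicit Type X : 'I_n -> {RV P >-> S}.

Definition mutually_independent X : Prop :=
  forall (J : {set 'I_n}) (A : 'I_n -> set S),
    (forall i, i \in J -> measurable (A i)) ->
    P (\bigcap_(i in [set` J]) X i @^-1` A i) =
    (\prod_(i in J) P (X i @^-1` A i))%E.

(* Equality of laws is required on measurable sets only: the value of [P] on a
   non-measurable set carries no meaning. *)
Definition identically_distributed X : Prop :=
  forall (i j : 'I_n) (A : set S), measurable A ->
    distribution P (X i) A = distribution P (X j) A.

Definition iid X : Prop := mutually_independent X /\ identically_distributed X.

End iid.

(* Main.v *)
Require Import Defs.
From HB Require Import structures.
From mathcomp Require Import all_boot all_order all_algebra.
From mathcomp Require Import fingroup perm ring lra.
From mathcomp Require Import all_classical all_reals all_analysis.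
From mathcomp Require Import measurable_realfun.

Set Implicit Arguments.
Unset Strict Implicit.
Unset Printing Implicit Defensive.

Import Order.TTheory GRing.Theory Num.Theory.

Local Open Scope classical_set_scope.
Local Open Scope ring_scope.

(** Write k for the integer part of n / m. The difficulty is that the summands
h(X_i) of U_n(h) are dependent, so that Hoeffding's inequality for sums of
independent variables does not apply directly. The remedy is to see U_n(h) as
a mean of means of independent variables. Cut the first k m indices into k
consecutive blocks e_0, ..., e_(k-1) of length m. For a permutation s of the
indices put
  V_s = (1/k) (h(X_(s e_0)) + ... + h(X_(s e_(k-1)))).
When s runs over all permutations, s e_l hits each injective m-tuple
(n - m)! times, so U_n(h) is the mean of the V_s over all n! permutations
[U_statistic_blocks].

For u >= 0, convexity of the exponential bounds exp(u (U_n(h) - m_h)) by the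
mean over s of exp(u (V_s - m_h)) [expR_mean_le]. For one s, the blocks s e_l
are disjoint and injective, so the variables h(X_(s e_l)) are independent
[expectation_prod_blocks] with the law of h(X_1, ..., X_m)
[expectation_subsample_eq]. The expectation of exp(u (V_s - m_h)) is thus the
k-th power of the moment generating function of h(X_1, ..., X_m) - m_h at
u / k, and Hoeffding's lemma [hoeffding_mgf_le] bounds it by
exp(u^2 len^2 / (8 k)). Markov's inequality for exp(u (U_n(h) - m_h)) with
u = 4 k t / len^2, which minimises u^2 len^2 / (8 k) - u t, gives the upper tail
[U_statistic_tail_le]. The lower tail is the upper tail of the kernel - h, and
the two-sided bound is their sum.

The probabilistic input rests on the uniqueness of finite measures that agree
on a pi-system: boxes generate the sigma-algebra of tuples
[measurable_tupleE], and on boxes both the independence and the equality of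
the laws of subfamilies of X are read off the hypotheses. *)

(** * Hoeffding's lemma *)

Lemma ge0_is_derive_nincr (R : realType) (f df : R -> R) :
  (forall x : R, 0 <= x -> is_derive x (1 : R) f (df x)) ->
  (forall x : R, 0 <= x -> df x <= 0) -> forall x, 0 <= x -> f x <= f 0.
Proof.
move=> fd df_le0 x x_ge0.
have ooP (y : R) : y \in `]0, x[ -> 0 <= y.
  by rewrite in_itv /= => /andP[/ltW].
apply: (@ler0_derive1_nincr R f 0 x) => //.
- by move=> y /ooP /fd [].
- move=> y /ooP y0; have [_] := fd y y0; rewrite derive1E => ->.
  exact: df_le0.
- apply: derivable_within_continuous => y.
  by rewrite in_itv /= => /andP[y0 _]; have [] := fd y y0.
Qed.

(** The heart of Hoeffding's lemma. Let q be the logarithmic derivative of the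
left-hand side. It satisfies q' = q (1 - q) <= 1 / 4 and q 0 = p, so
q u <= p + u / 4; integrating once more gives p * u + u ^+ 2 / 8. *)
Lemma bernoulli_mgf_le (R : realType) (p u : R) :
  0 <= p <= 1 -> 0 <= u -> 1 - p + p * expR u <= expR (p * u + u ^+ 2 / 8).
Proof.
move=> /andP[p0 p1] u0.
pose D (x : R) : R := 1 - p + p * expR x.
have D_gt0 (x : R) : 0 < D x.
  rewrite /D; have [->|pn0] := eqVneq p 0.
    by rewrite mul0r subr0 addr0 ltr01.
  by rewrite ltr_wpDl ?subr_ge0// mulr_gt0 ?expR_gt0// lt0r pn0.
have D_neq0 (x : R) : D x != 0 by rewrite gt_eqF.
have D_derive (x : R) : is_derive x (1 : R) D (p * expR x).
  apply: (is_derive_eq (is_deriveD (is_derive_cst (1 - p) _ _)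
    (is_deriveZ p (is_derive_expR x)))).
  by rewrite add0r.
pose q (y : R) : R := p * expR y / D y.
have q_derive (y : R) : is_derive y (1 : R) q (q y * (1 - q y)).
  apply: (is_derive_eq (is_deriveM (is_deriveZ p (is_derive_expR y))
     (is_deriveV (D_neq0 y) (D_derive y)))).
  rewrite /q [LHS](_ : _ = p * expR y * (- D y ^- 2 * (p * expR y)) +
    (D y)^-1 * (p * expR y))//.
  by field.
have lin_derive (c y : R) :
    is_derive y (1 : R) (fun z : R => p + z * c) c.
  apply: (is_derive_eq (is_deriveD (is_derive_cst p _ _)
    (is_deriveM (is_derive_id y 1) (is_derive_cst c y 1)))).
  by rewrite /GRing.scale /= mulr0 !add0r mulr1.
have q_le (x : R) : 0 <= x -> q x - (p + x / 4) <= 0.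
  move=> x0.
  have -> : 0 = q 0 - (p + 0 / 4) :> R.
    by rewrite /q /D expR0 mulr1 subrK divr1 mul0r addr0 subrr.
  apply: (@ge0_is_derive_nincr R (fun y => q y - (p + y / 4))
    (fun y => q y * (1 - q y) - 4^-1)) => // y _.
  by move: (sqr_ge0 (q y - 1 / 2)); rewrite expr2 /=; lra.
have quad_derive (y : R) :
    is_derive y (1 : R) (fun z : R => z * (p + z / 8)) (p + y / 4).
  apply: (is_derive_eq (is_deriveM (is_derive_id y 1) (lin_derive 8^-1 y))).
  by rewrite /GRing.scale /=; field.
have : ln (D u) - u * (p + u / 8) <= 0.
  have -> : 0 = ln (D 0) - 0 * (p + 0 / 8) :> R.
    by rewrite /D expR0 mulr1 subrK ln1 mul0r subrr.
  apply: (@ge0_is_derive_nincr R (fun y => ln (D y) - y * (p + y / 8))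
    (fun y => q y - (p + y / 4))) => // y _.
  apply: (is_derive_eq (is_deriveB
    (is_derive1_comp (is_derive1_ln (D_gt0 y)) (D_derive y)) (quad_derive y))).
  by rewrite /q [in RHS]mulrC.
rewrite subr_le0 => le_ln; rewrite -[leLHS]lnK ?posrE ?D_gt0//.
by rewrite ler_expR (le_trans le_ln)//; lra.
Qed.

Lemma expR_tangent_le (R : realType) (x y : R) :
  expR y * (1 + (x - y)) <= expR x.
Proof.
rewrite -[X in _ <= expR X](subrKC y) expRD ler_pM2l ?expR_gt0//.
exact: expR_ge1Dx.
Qed.

(** Jensen's inequality for a finite mean: average the tangent at the mean c,
whose linear part averages to 0. *)
Lemma expR_mean_le (R : realType) (I : finType) (v : I -> R) : (0 < #|I|)%N ->
  expR (#|I|%:R^-1 * \sum_i v i) <= #|I|%:R^-1 * \sum_i expR (v i).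
Proof.
move=> I_gt0; set c := _ * \sum_i v i.
have n_neq0 : #|I|%:R != 0 :> R by rewrite pnatr_eq0 -lt0n.
have -> : expR c = #|I|%:R^-1 * \sum_i expR c * (1 + (v i - c)).
  rewrite -mulr_sumr big_split sumrB !sumr_const /= -[c *+ _]mulr_natl.
  by rewrite mulVKf// subrr addr0 mulrCA mulVf// mulr1.
rewrite ler_pM2l ?invr_gt0 ?ltr0n//.
by apply: ler_sum => i _; exact: expR_tangent_le.
Qed.

(** Convexity of the exponential between a and b: weight the tangent at s * z,
taken at s * a and s * b, by b - z and z - a; the linear parts cancel. *)
Lemma expR_chord_le (R : realType) (a b s z : R) : a <= z <= b ->
  (b - a) * expR (s * z) <= (b - z) * expR (s * a) + (z - a) * expR (s * b).
Proof.
move=> /andP[az zb].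
have -> : (b - a) * expR (s * z) =
    (b - z) * (expR (s * z) * (1 + (s * a - s * z))) +
    (z - a) * (expR (s * z) * (1 + (s * b - s * z))) by ring.
by apply: lerD; rewrite ler_wpM2l ?subr_ge0// expR_tangent_le.
Qed.

Section bounded.
Context d (T : measurableType d) (R : realType) (P : probability T R).
Variables (Z : T -> R) (a b : R).
Hypotheses (mZ : measurable_fun [set: T] Z) (Zab : forall w, a <= Z w <= b).

Lemma bounded_integrable : P.-integrable [set: T] (EFin \o Z).
Proof.
apply: measurable_bounded_integrable => //.
  by rewrite (_ : _ setT = 1%E) ?ltry//; exact: (probability_setT P).
exists (`|a| + `|b|); split; first exact: num_real.
move=> x abx w _ /=; apply: le_trans (ltW abx).
have /andP[aZ Zb] := Zab w; rewrite ler_norml.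
have := ler_norm (- a); have := ler_norm b; rewrite normrN.
have := normr_ge0 a; have := normr_ge0 b; lra.
Qed.

Lemma expectation_bounded :
  ('E_P[Z])%E = (fine 'E_P[Z])%:E /\ a <= fine 'E_P[Z] <= b.
Proof.
have iZ := bounded_integrable.
have fin : ('E_P[Z])%E \is a fin_num.
  by rewrite unlock; exact: integrable_fin_num.
rewrite fineK//; split=> //; rewrite -!lee_fin fineK//.
have cst_int (c : R) : (c%:E = \int[P]_w c%:E)%E.
  by rewrite integral_cst//= probability_setT mule1.
rewrite unlock (cst_int a) (cst_int b); apply/andP; split.
  apply: le_integral => //.
    by apply: finite_measure_integrable_cst.
  by move=> w _; rewrite lee_fin /=; case/andP: (Zab w).
apply: le_integral => //.
  by apply: finite_measure_integrable_cst.
by move=> w _; rewrite lee_fin /=; case/andP: (Zab w).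
Qed.

(** Bounding exp by its chord on [a, b] makes the integrand affine in Z, so that
only the mean of Z matters. What is left is the moment generating function of
the two-point law on {a, b} with that mean. *)
Lemma hoeffding_mgf_le s : a < b -> 0 <= s ->
  (\int[P]_w (expR (s * (Z w - fine 'E_P[Z])))%:E <=
   (expR (s ^+ 2 * (b - a) ^+ 2 / 8))%:E)%E.
Proof.
move=> ab s0; have [EZ /andP[aE Eb]] := expectation_bounded.
move: aE Eb EZ; set mu := fine _ => amu mub EZ.
have ba0 : 0 < b - a by rewrite subr_gt0.
pose A := expR (s * (a - mu)) / (b - a).
pose B := expR (s * (b - mu)) / (b - a).
pose c0 := b * A - a * B.
pose c1 := B - A.
have chord w : expR (s * (Z w - mu)) <= c0 + c1 * Z w.
  have := @expR_chord_le R (a - mu) (b - mu) s (Z w - mu).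
  rewrite !lerD2r => /(_ (Zab w)).
  have -> : b - mu - (a - mu) = b - a by ring.
  rewrite -ler_pdivlMl// => /le_trans; apply.
  rewrite /c0 /c1 /A /B le_eqVlt; apply/orP; left; apply/eqP.
  by field; rewrite gt_eqF.
have iZ := bounded_integrable.
have iC : P.-integrable [set: T] (EFin \o cst c0).
  exact: finite_measure_integrable_cst.
have iZc : P.-integrable [set: T] (fun w => c1%:E * (EFin \o Z) w)%E.
  exact: integrableZl.
have iL := integrableD measurableT iC iZc.
apply: (@le_trans _ _ (\int[P]_w (c0 + c1 * Z w)%:E)%E).
  apply: ge0_le_integral => //.
  - apply/measurable_EFinP; apply: measurableT_comp => //.
    by apply: measurable_funM => //; exact: measurable_funB.
  - exact: (measurable_int P).
  - by move=> w _; rewrite lee_fin.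
have -> : (\int[P]_w (c0 + c1 * Z w)%:E = (c0 + c1 * mu)%:E)%E.
  transitivity (\int[P]_w ((EFin \o cst c0) w + c1%:E * (EFin \o Z) w))%E.
    by [].
  rewrite (integralD measurableT iC iZc) (integralZl measurableT iZ).
  rewrite (_ : \int[P]_x _ = c0%:E)%E; last first.
    rewrite -[LHS]/(\int[P]_w c0%:E)%E integral_cst//=.
    by rewrite probability_setT mule1.
  by rewrite -[RHS]/(c0%:E + c1%:E * mu%:E)%E -EZ unlock.
(* The mass at b of the law on {a, b} with mean mu. *)
rewrite lee_fin; pose p := (mu - a) / (b - a).
have p01 : 0 <= p <= 1.
  rewrite /p divr_ge0 ?subr_ge0// ?(ltW ab)//=.
  by rewrite ler_pdivrMr// mul1r lerD2r.
have := @bernoulli_mgf_le R p (s * (b - a)) p01.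
rewrite mulr_ge0 ?(ltW ba0)// => /(_ isT).
rewrite -(ler_pM2l (expR_gt0 (s * (a - mu)))) -expRD.
have -> : s * (a - mu) + (p * (s * (b - a)) + (s * (b - a)) ^+ 2 / 8) =
    s ^+ 2 * (b - a) ^+ 2 / 8 by rewrite /p; field; rewrite gt_eqF.
apply: le_trans.
have BE : B = A * expR (s * (b - a)).
  rewrite /A mulrAC -expRD /B; congr (expR _ / _); ring.
rewrite /c0 /c1 BE /A /p le_eqVlt; apply/orP; left; apply/eqP.
by field; rewrite gt_eqF.
Qed.

End bounded.

(** * Independence and laws of subfamilies *)

Section tuple_boxes.
Context d (S : measurableType d) (p : nat).

Definition box (A : 'I_p -> set S) : set (p.-tuple S) :=
  [set x | forall j, A j (tnth x j)].

Definition boxes : set (set (p.-tuple S)) :=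
  [set B | exists2 A, (forall j, measurable (A j)) & B = box A].

Lemma measurable_box A : (forall j, measurable (A j)) -> measurable (box A).
Proof.
move=> mA.
have -> : box A = \bigcap_(j in [set: 'I_p]) ((@tnth p S ^~ j) @^-1` A j).
  by apply/seteqP; split => x Ax j; [move=> _|]; exact: Ax.
apply: fin_bigcap_measurable; first exact: finite_finset.
move=> j _.
by rewrite -[X in measurable X]setTI; exact: measurable_tnth.
Qed.

(** The sigma-algebra of tuples is defined from the coordinate projections; a
preimage under the i-th projection is a box with full sides away from i. *)
Lemma measurable_tupleE : @measurable _ (p.-tuple S) = <<s boxes >>.
Proof.
rewrite eqEsubset; split.
  rewrite {1}/measurable /= /g_sigma_preimage; apply: smallest_sub.
    exact: smallest_sigma_algebra.
  rewrite -bigcup_seq => B [i _] /= [C mC <-].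
  apply: sub_sigma_algebra => /=.
  exists (fun j => if j == i then C else setT).
    by move=> j; case: ifP.
  rewrite setTI; apply/seteqP; split => x /= Cx.
    by move=> j; case: eqP => [->|].
  by have := Cx i; rewrite eqxx.
apply: smallest_sub; first exact: sigma_algebra_measurable.
by move=> _ [A mA ->]; exact: measurable_box.
Qed.

Lemma boxT : box (fun=> setT) = setT.
Proof. by apply/seteqP; split. Qed.

Lemma setI_closed_boxes : setI_closed boxes.
Proof.
move=> _ _ [A mA ->] [B mB ->]; exists (fun j => A j `&` B j).
  by move=> j; exact: measurableI.
apply/seteqP; split => x /=; first by move=> [Ax Bx] j; split.
by move=> ABx; split => j; have [] := ABx j.
Qed.

(** Boxes are stable under intersection and generate the sigma-algebra, so they
determine a finite measure. *)
Lemma boxes_measure_unique (R : realType)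
    (m1 m2 : {measure set (p.-tuple S) -> \bar R}) :
  (m1 setT < +oo)%E ->
  (forall A, (forall j, measurable (A j)) -> m1 (box A) = m2 (box A)) ->
  forall B, measurable B -> m1 B = m2 B.
Proof.
move=> m1T m12; apply: (measure_unique boxes (fun=> setT)) => //.
- exact: measurable_tupleE.
- exact: setI_closed_boxes.
- by move=> _; exists (fun=> setT) => //; rewrite boxT.
- by rewrite bigcup_const//; exists 0%N.
- by move=> _ [A mA ->]; exact: m12.
Qed.

End tuple_boxes.

Section subsample.
Context d d' (T : measurableType d) (S : measurableType d') (R : realType)
  (P : probability T R) (n : nat) (X : 'I_n -> {RV P >-> S}).

Definition subsample p (b : 'I_p -> 'I_n) (w : T) : p.-tuple S :=
  [tuple X (b j) w | j < p].

Lemma measurable_subsample p (b : 'I_p -> 'I_n) :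
  measurable_fun [set: T] (subsample b).
Proof.
apply/measurable_fun_tnthP => j.
rewrite (_ : _ \o _ = X (b j)) //.
by apply/funext => w; rewrite /= tnth_mktuple.
Qed.

HB.instance Definition _ p (b : 'I_p -> 'I_n) :=
  isMeasurableFun.Build _ _ _ _ (subsample b) (measurable_subsample b).

Lemma measurable_subsample_preimage p (b : 'I_p -> 'I_n) B :
  measurable B -> measurable (subsample b @^-1` B).
Proof.
by move=> mB; rewrite -[X in measurable X]setTI; exact: measurable_subsample.
Qed.

(** For a fixed event E, both sides are finite measures in B: the law of the
subfamily under P restricted to E, and a multiple of its law under P. *)
Lemma subsample_indep_box p (b : 'I_p -> 'I_n) (E : set T) : measurable E ->
  (forall A, (forall j, measurable (A j)) ->
    P (subsample b @^-1` box A `&` E) =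
    (P (subsample b @^-1` box A) * P E)%E) ->
  forall B, measurable B ->
    P (subsample b @^-1` B `&` E) = (P (subsample b @^-1` B) * P E)%E.
Proof.
move=> mE indep B mB.
have PE : P E \is a fin_num by exact: fin_num_measure.
have PE0 : 0 <= fine (P E) by exact/fine_ge0/measure_ge0.
pose m2 := mscale (NngNum PE0) (distribution P (subsample b)).
rewrite [RHS]muleC -(fineK PE).
have := @boxes_measure_unique _ S p R
  (pushforward (mrestr P mE) (subsample b)) m2.
move=> /(_ (measurable_subsample b)); apply => //.
- rewrite /pushforward /mrestr ltey_eq fin_num_measure//.
  exact: measurable_subsample_preimage.
- move=> A mA; transitivity ((fine (P E))%:E * P (subsample b @^-1` box A))%E.
    by rewrite fineK// muleC -indep.
  by [].
Qed.

(** The side that the index i of the whole family receives from a box on the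
indices b. The intersection allows b to repeat an index, and it is the full
space when i is not in the range of b. *)
Definition pulled_back p (b : 'I_p -> 'I_n) (A : 'I_p -> set S) (i : 'I_n) :=
  \bigcap_(j in [set j | b j = i]) A j.

Lemma measurable_pulled_back p (b : 'I_p -> 'I_n) A i :
  (forall j, measurable (A j)) -> measurable (pulled_back b A i).
Proof. by move=> mA; apply: fin_bigcap_measurable. Qed.

Lemma subsample_box p (b : 'I_p -> 'I_n) A (J : {set 'I_n}) :
  (forall j, b j \in J) ->
  subsample b @^-1` box A =
  \bigcap_(i in [set` J]) X i @^-1` pulled_back b A i.
Proof.
move=> bJ; apply/seteqP; split => w /= Aw.
  by move=> i _ j /= <-; have := Aw j; rewrite tnth_mktuple.
by move=> j; rewrite tnth_mktuple; apply: (Aw (b j)) => //=.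
Qed.

Hypothesis X_indep : mutually_independent X.

(** Extend from boxes to measurable sets in one argument at a time. For two
boxes the event is a box on the whole family, and at each index at most one
of the two factors constrains the variable. Neither b nor c has to be
injective; this freedom is used in [expectation_prod_blocks]. *)
Lemma subsamples_indep p q (b : 'I_p -> 'I_n) (c : 'I_q -> 'I_n) :
  (forall j l, b j <> c l) -> forall B C, measurable B -> measurable C ->
  P (subsample b @^-1` B `&` subsample c @^-1` C) =
  (P (subsample b @^-1` B) * P (subsample c @^-1` C))%E.
Proof.
move=> bc B C mB mC; move: B mB.
apply: subsample_indep_box; first exact: measurable_subsample_preimage.
move=> A mA; rewrite setIC [RHS]muleC; move: C mC.
apply: subsample_indep_box.
  by apply: measurable_subsample_preimage; exact: measurable_box.
move=> A' mA'; rewrite (subsample_box A (fun j => finset.in_setT (b j))).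
rewrite (subsample_box A' (fun j => finset.in_setT (c j))) -bigcapI.
under eq_bigcapr do rewrite -preimage_setI.
have mb := measurable_pulled_back b _ mA.
have mc := measurable_pulled_back c _ mA'.
rewrite !X_indep; try by move=> i _ //; exact: measurableI.
rewrite -big_split /=; apply: eq_bigr => i _.
have [[j <-]|bi] := pselect (exists j, b j = i).
  have -> : pulled_back c A' (b j) = setT.
    by rewrite /pulled_back; apply/seteqP; split => // x _ l /= /esym /bc.
  by rewrite setTI preimage_setT probability_setT mul1e.
have -> : pulled_back b A i = setT.
  by apply/seteqP; split => // x _ j /= bji; case: bi; exists j.
by rewrite setIT preimage_setT probability_setT mule1.
Qed.

(** Injectivity of b turns the product over its range into a product over j. *)
Lemma prob_subsample_box p (b : 'I_p -> 'I_n) A : injective b ->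
  (forall j, measurable (A j)) ->
  P (subsample b @^-1` box A) = (\prod_(j < p) P (X (b j) @^-1` A j))%E.
Proof.
move=> b_inj mA.
rewrite (@subsample_box _ _ _ (b @: [set: 'I_p])%SET); last first.
  by move=> j; apply: imset_f; rewrite inE.
rewrite X_indep; last by move=> i _; exact: measurable_pulled_back.
rewrite big_imset /=; last by move=> i j _ _; exact: b_inj.
rewrite big_mkcond /=; apply: eq_bigr => j _; rewrite inE.
congr (P (_ @^-1` _)); apply/seteqP; split => x /=; first exact.
by move=> Ax i /b_inj ->.
Qed.

Lemma subsample_identically_distributed p (b c : 'I_p -> 'I_n) :
  identically_distributed X -> injective b -> injective c ->
  forall B, measurable B -> P (subsample b @^-1` B) = P (subsample c @^-1` B).
Proof.
move=> X_id b_inj c_inj B mB.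
change (distribution P (subsample b) B = distribution P (subsample c) B).
apply: boxes_measure_unique => //.
  by rewrite (_ : _ setT = 1%E) ?ltry//; exact: (probability_setT P).
move=> A mA; transitivity (P (subsample b @^-1` box A)) => //.
rewrite prob_subsample_box//; transitivity (P (subsample c @^-1` box A)) => //.
by rewrite prob_subsample_box//; apply: eq_bigr => j _; exact: X_id.
Qed.

Lemma expectation_subsample_eq p (b c : 'I_p -> 'I_n) (f : p.-tuple S -> R) :
  identically_distributed X -> injective b -> injective c ->
  measurable_fun [set: p.-tuple S] f -> (forall x, 0 <= f x) ->
  (\int[P]_w (f (subsample b w))%:E = \int[P]_w (f (subsample c w))%:E)%E.
Proof.
move=> X_id b_inj c_inj mf f0.
have law (e : 'I_p -> 'I_n) : (\int[P]_w (f (subsample e w))%:E =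
    \int[distribution P (subsample e)]_x (f x)%:E)%E.
  by rewrite ge0_integral_distribution//; exact/measurable_EFinP.
rewrite !law; apply: eq_measure_integral => B mB _.
exact: subsample_identically_distributed.
Qed.

(** By independence the pair of subfamilies has a product law; conclude with
Tonelli's theorem. *)
Lemma expectation_subsamples_mul p q (b : 'I_p -> 'I_n) (c : 'I_q -> 'I_n)
    (f : p.-tuple S -> R) (g : q.-tuple S -> R) :
  (forall j l, b j <> c l) ->
  measurable_fun [set: p.-tuple S] f -> (forall x, 0 <= f x) ->
  measurable_fun [set: q.-tuple S] g -> (forall x, 0 <= g x) ->
  (\int[P]_w (f (subsample b w) * g (subsample c w))%:E =
   (\int[P]_w (f (subsample b w))%:E) * (\int[P]_w (g (subsample c w))%:E))%E.
Proof.
move=> bc mf f0 mg g0.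
pose m1 := distribution P (subsample b).
pose m2 := distribution P (subsample c).
pose Y w := (subsample b w, subsample c w).
have mY : measurable_fun [set: T] Y.
  by apply: measurable_fun_pair; exact: measurable_subsample.
pose Ym : {mfun T >-> _} := HB.pack Y (isMeasurableFun.Build _ _ _ _ Y mY).
have lawY B : measurable B -> (m1 \x m2)%E B = distribution P Ym B.
  apply: product_measure_unique => B1 B2 mB1 mB2.
  by rewrite /distribution /pushforward -subsamples_indep.
pose fg (z : p.-tuple S * q.-tuple S) := (f z.1 * g z.2)%:E.
have mfg : measurable_fun setT fg.
  apply/measurable_EFinP; apply: measurable_funM; exact: measurableT_comp.
have fg0 z : (0 <= fg z)%E by rewrite lee_fin mulr_ge0.
transitivity (\int[distribution P Ym]_z fg z)%E.
  by rewrite ge0_integral_distribution.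
rewrite (eq_measure_integral (m1 \x m2)%E); last first.
  by move=> B mB _; exact/esym/lawY.
rewrite fubini_tonelli1//.
have mfE : measurable_fun setT (EFin \o f) by exact/measurable_EFinP.
have mgE : measurable_fun setT (EFin \o g) by exact/measurable_EFinP.
transitivity (\int[m1]_x ((f x)%:E * \int[m2]_y (g y)%:E))%E.
  apply: eq_integral => x _; rewrite /fubini_F /fg /=.
  by rewrite -ge0_integralZl// ?lee_fin// => y _; rewrite lee_fin.
rewrite ge0_integralZr//; last 2 first.
- by move=> y _; rewrite lee_fin.
- by apply: integral_ge0 => y _; rewrite lee_fin.
have -> : (\int[m1]_x (f x)%:E = \int[P]_w (f (subsample b w))%:E)%E.
  by apply: ge0_integral_distribution => // y; rewrite lee_fin.
have -> // : (\int[m2]_x (g x)%:E = \int[P]_w (g (subsample c w))%:E)%E.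
by apply: ge0_integral_distribution => // y; rewrite lee_fin.
Qed.
(** Induction on the list of blocks. To split off the block B k, the product
over the other blocks has to be a function of a subfamily that avoids B k. This
subfamily is indexed by all of 'I_n, with the indices in B k replaced by an
arbitrary index of another block: the other blocks do not see the change. *)
Lemma expectation_prod_blocks m (I : eqType) (B : I -> 'I_m -> 'I_n)
    (f : m.-tuple S -> R) (s : seq I) :
  (0 < m)%N -> uniq s ->
  (forall k l, k != l -> forall i j, B k i <> B l j) ->
  measurable_fun [set: m.-tuple S] f -> (forall x, 0 <= f x) ->
  (\int[P]_w (\prod_(l <- s) f (subsample (B l) w))%:E =
   \prod_(l <- s) \int[P]_w (f (subsample (B l) w))%:E)%E.
Proof.
move=> m_gt0 + B_disj mf f0; elim: s => [_|k s IHs /= /andP[ks us]].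
  rewrite big_nil; under eq_integral do rewrite big_nil.
  by rewrite integral_cst//= probability_setT mule1.
rewrite big_cons -IHs//; under eq_integral do rewrite big_cons.
(* If B k is the last block, there may be no index outside B k. *)
case: s ks us {IHs} => [|l s] ks us.
  rewrite [X in (_ * X)%E](_ : _ = 1%E) ?mule1; last first.
    under eq_integral do rewrite big_nil.
    by rewrite integral_cst//= probability_setT mule1.
  by apply: eq_integral => w _; rewrite big_nil mulr1.
have kl : k != l by move: ks; rewrite inE negb_or => /andP[].
pose i0 := B l (Ordinal m_gt0).
pose c (i : 'I_n) := if [exists j, B k j == i] then i0 else i.
have Bkc j i : B k j <> c i.
  rewrite /c; case: ifP => [_|/negbT/existsPn/(_ j)/eqP//].
  exact: B_disj.
pose g (y : n.-tuple S) : R :=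
  \prod_(l' <- l :: s) f [tuple tnth y (B l' j) | j < m].
have mg : measurable_fun [set: n.-tuple S] g.
  apply: measurable_prod => l' _; apply: measurableT_comp => //.
  apply/measurable_fun_tnthP => j; rewrite (_ : _ \o _ = @tnth n S ^~ (B l' j)).
    exact: measurable_tnth.
  by apply/funext => y; rewrite /= tnth_mktuple.
have gE w : \prod_(l' <- l :: s) f (subsample (B l') w) = g (subsample c w).
  rewrite /g !big_seq; apply: eq_bigr => l' l's; congr f.
  apply: eq_from_tnth => j; rewrite !tnth_mktuple /c.
  case: ifP => // /existsP[j' /eqP]/B_disj; case.
  by apply: contra ks => /eqP ->.
under eq_integral do rewrite gE.
rewrite expectation_subsamples_mul//; last first.
  by move=> y; apply: prodr_ge0 => l' _.
by congr (_ * _)%E; apply: eq_integral => w _; rewrite gE.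
Qed.

End subsample.

(** * Averaging over permutations *)

(** Adjust the permutation one value at a time: composing with a transposition
corrects the value at b r and keeps the earlier ones, by injectivity of b
and c. *)
Lemma perm_extending m n (b c : 'I_m -> 'I_n) : injective b -> injective c ->
  exists s : {perm 'I_n}, forall j, s (b j) = c j.
Proof.
move=> b_inj c_inj.
suff H r : exists s : {perm 'I_n}, forall j : 'I_m, (j < r)%N -> s (b j) = c j.
  by have [s sP] := H m; exists s => j; exact: sP.
elim: r => [|r [s sP]]; first by exists 1%g.
have [rm|mr] := ltnP r m; last first.
  by exists s => j _; apply: sP; exact: leq_trans mr.
pose r' := Ordinal rm.
exists (s * tperm (s (b r')) (c r'))%g => j; rewrite ltnS leq_eqVlt permM.
have [->|jr /=] := eqVneq j r'; first by rewrite tpermL.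
have -> : (j == r :> nat) = false by apply/negbTE; move: jr; rewrite -val_eqE.
move=> /= ltjr; rewrite -[in RHS](sP j)// tpermD//.
  by apply: contra jr => /eqP/perm_inj/b_inj ->.
by rewrite sP//; apply: contra jr => /eqP/c_inj ->.
Qed.

(** Group the permutations by the image of b. The groups have the same size N,
since composing with a permutation that sends one tuple to another maps one
group to the other. The value of N follows by counting all permutations. *)
Lemma sum_perm_injective_tuples (V : nmodType) m n (b : 'I_m -> 'I_n)
    (F : m.-tuple 'I_n -> V) : (m <= n)%N -> injective b ->
  \sum_(s : {perm 'I_n}) F [tuple s (b j) | j < m] =
  (\sum_(i in injective_tuples m n) F i) *+ (n - m)`!.
Proof.
move=> mn b_inj.
pose act (s : {perm 'I_n}) : m.-tuple 'I_n := [tuple s (b j) | j < m].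
have act_inj s : act s \in injective_tuples m n.
  rewrite inE map_inj_uniq ?enum_uniq//.
  by move=> j l /perm_inj/b_inj.
pose fiber i : {set {perm 'I_n}} := [set s | act s == i]%SET.
pose N := #|fiber (act 1%g)|.
have card_fiber i : i \in injective_tuples m n ->
    #|fiber i| = N.
  rewrite inE => /tuple_uniqP i_inj.
  have [t tP] := perm_extending b_inj i_inj.
  have -> : fiber i = [set (s * t)%g | s in fiber (act 1%g)]%SET.
    apply/setP => s; apply/idP/imsetP.
      rewrite inE => /eqP si; exists (s * t^-1)%g; last by rewrite mulgKV.
      rewrite inE; apply/eqP/eq_from_tnth => j.
      have := congr1 (fun y => tnth y j) si.
      by rewrite /act !tnth_mktuple permM perm1 => ->; rewrite -tP permK.
    move=> [s0]; rewrite inE => /eqP s0E ->; rewrite inE.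
    apply/eqP/eq_from_tnth => j; rewrite tnth_mktuple permM -tP; congr (t _).
    have := congr1 (fun y => tnth y j) s0E.
    by rewrite /act !tnth_mktuple perm1.
  by rewrite card_imset//; exact: mulIg.
have sumE (W : nmodType) (G : m.-tuple 'I_n -> W) :
    \sum_(s : {perm 'I_n}) G (act s) =
    (\sum_(i in injective_tuples m n) G i) *+ N.
  rewrite (partition_big act (mem (injective_tuples m n)))//=.
  rewrite -sumrMnl; apply: eq_bigr => i iI; rewrite -(card_fiber i iI).
  rewrite -sumr_const; apply: eq_big => [s|s /eqP -> //].
  by rewrite inE.
rewrite sumE; congr (_ *+ _).
(* The constant function 1 counts n`! = n ^_ m * N. *)
have := sumE nat (fun=> 1%N).
rewrite !sumr_const card_Sn.
have -> : #|injective_tuples m n| = (n ^_ m)%N.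
  rewrite -[n in RHS]card_ord -card_uniq_tuples; apply: eq_card => i.
  by rewrite !inE all_predT.
rewrite -mulrnA !natn -(ffact_fact mn) => /eqP.
by rewrite eqn_pmul2l ?ffact_gt0// => /eqP.
Qed.

Lemma U_statistic_perm (R : realType) (S : Type) m n (b : 'I_m -> 'I_n)
    (h : m.-tuple S -> R) (x : 'I_n -> S) : (m <= n)%N -> injective b ->
  U_statistic h x =
  n`!%:R^-1 * \sum_(s : {perm 'I_n}) h [tuple x (s (b j)) | j < m].
Proof.
move=> mn b_inj; rewrite /U_statistic.
pose F (i : m.-tuple 'I_n) := h [tuple x (tnth i j) | j < m].
rewrite (eq_bigr (fun s : {perm 'I_n} => F [tuple s (b j) | j < m])).
  rewrite sum_perm_injective_tuples// -[X in _ = _ * X]mulr_natl.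
  by rewrite mulrCA mulrA.
move=> s _; congr h; apply: eq_from_tnth => j.
by rewrite !tnth_mktuple.
Qed.

(** * Exponential inequality for the U-statistic *)

Section hoeffding_U.
Context (R : realType) (d d' : measure_display)
  (T : measurableType d) (S : measurableType d') (P : probability T R)
  (m n : nat) (m_gt0 : (0 < m)%N) (m_le_n : (m <= n)%N)
  (X : 'I_n -> {RV P >-> S}) (X_iid : iid X).

Local Notation k := (n %/ m)%N.

Lemma block_index_subproof (l : 'I_k) (j : 'I_m) : (l * m + j < n)%N.
Proof.
apply: (@leq_trans (l.+1 * m)); first by rewrite mulSn addnC ltn_add2r.
by rewrite (leq_trans _ (leq_divM n m))// leq_mul2r ltn_ord orbT.
Qed.

Definition block_index l j : 'I_n := Ordinal (block_index_subproof l j).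

Lemma block_index_inj l l' j j' :
  block_index l j = block_index l' j' -> l = l' /\ j = j'.
Proof.
move=> /(congr1 val) /= eq_lj; split; apply: val_inj => /=.
  have := congr1 (divn^~ m) eq_lj.
  have j_div (i : 'I_m) : (i %/ m = 0)%N by exact/divn_small/ltn_ord.
  by rewrite /= !divnMDl// !j_div !addn0.
have := congr1 (modn^~ m) eq_lj.
by rewrite /= !modnMDl !modn_small ?ltn_ord.
Qed.

Let k_gt0 : (0 < k)%N. Proof. by rewrite divn_gt0. Qed.

(** Each block contributes the same mean over permutations, namely the
U-statistic itself, and averaging k equal terms changes nothing. *)
Lemma U_statistic_blocks (h : m.-tuple S -> R) (x : 'I_n -> S) :
  U_statistic h x = n`!%:R^-1 * \sum_(s : {perm 'I_n})
    (k%:R^-1 * \sum_(l < k) h [tuple x (s (block_index l j)) | j < m]).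
Proof.
rewrite -mulr_sumr exchange_big /= mulrCA mulr_sumr.
rewrite (eq_bigr (fun=> U_statistic h x)); last first.
  move=> l _; rewrite (@U_statistic_perm _ _ _ _ (block_index l))//.
  by move=> j j' /block_index_inj[].
rewrite sumr_const card_ord -[U_statistic h x *+ _]mulr_natl mulrA.
rewrite mulVf ?mul1r//.
by rewrite pnatr_eq0 -lt0n.
Qed.

Variables (h : m.-tuple S -> R) (a b : R).
Hypotheses (h_meas : measurable_fun [set: m.-tuple S] h)
  (h_ab : forall x, a <= h x <= b) (ab : a < b).

Let mean :=
  fine 'E_P[fun w => h [tuple X (widen_ord m_le_n j) w | j < m]].

Lemma measurable_U_statistic :
  measurable_fun [set: T] (fun w => U_statistic h (fun i => X i w)).
Proof.
apply: measurable_funM => //.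
rewrite (_ : (fun w => _) = (fun w => \sum_i
    if i \in injective_tuples m n then h (subsample X (tnth i) w) else 0)).
  apply: measurable_sum => i; case: (i \in injective_tuples m n) => //.
  by apply: measurableT_comp => //; exact: measurable_subsample.
by apply/funext => w; rewrite -big_mkcond.
Qed.

(** The blocks moved by s stay disjoint and injective, so Hoeffding's lemma
applies to each factor. *)
Lemma block_mgf_le (s : {perm 'I_n}) (u : R) : 0 <= u ->
  (\int[P]_w (\prod_(l < k) expR (u *
     (h (subsample X (fun j => s (block_index l j)) w) - mean)))%:E <=
   (expR (u ^+ 2 * (b - a) ^+ 2 / 8 * k%:R))%:E)%E.
Proof.
move=> u_ge0; pose f (x : m.-tuple S) := expR (u * (h x - mean)).
have mf : measurable_fun [set: m.-tuple S] f.
  apply: measurableT_comp => //.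
  by apply: measurable_funM => //; exact: measurable_funB.
have f_ge0 x : 0 <= f x by exact: expR_ge0.
have [X_indep X_id] := X_iid.
rewrite (expectation_prod_blocks X_indep (B := fun l j => s (block_index l j))
  (f := f) m_gt0 (index_enum_uniq _))//; last first.
  by move=> l l' ll' i j /perm_inj/block_index_inj[ll]; rewrite ll eqxx in ll'.
pose M := expR (u ^+ 2 * (b - a) ^+ 2 / 8).
rewrite expRM_natr -/M -[k in (M ^+ k)]card_ord -prodr_const.
suff : (0 <= \prod_(l < k) \int[P]_w
    (f (subsample X (fun j => s (block_index l j)) w))%:E <=
    (\prod_(l < k) M)%:E)%E by move=> /andP[].
apply: (big_rec2 (fun x y => (0 <= x <= y%:E)%E)).
  by rewrite lee_fin ler01 lexx.
move=> l y x _ /andP[x_ge0 xy].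
set I := (\int[P]_w _)%E.
have I_ge0 : (0 <= I)%E by apply: integral_ge0 => w _; rewrite lee_fin.
have IM : (I <= M%:E)%E.
  pose Z (w : T) := h [tuple X (widen_ord m_le_n j) w | j < m].
  have mZ : measurable_fun [set: T] Z.
    by apply: measurableT_comp => //; exact: measurable_subsample.
  have := @hoeffding_mgf_le _ _ _ P Z a b mZ (fun w => h_ab _) u ab u_ge0.
  apply: le_trans; rewrite /I.
  rewrite (expectation_subsample_eq X_indep (c := widen_ord m_le_n) X_id)//.
  - by move=> j j' /perm_inj/block_index_inj[].
  - by move=> j j' /(congr1 val) /= jj'; exact: val_inj.
by rewrite mule_ge0//= EFinM lee_pmul.
Qed.

Lemma U_statistic_mgf_le (u : R) : 0 <= u ->
  (\int[P]_w (expR (u * (U_statistic h (fun i => X i w) - mean)))%:E <=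
   (expR (u ^+ 2 * (b - a) ^+ 2 / (8 * k%:R)))%:E)%E.
Proof.
move=> u_ge0; pose v := u / k%:R.
have k_neq0 : k%:R != 0 :> R by rewrite pnatr_eq0 -lt0n.
pose g (s : {perm 'I_n}) (w : T) := \prod_(l < k) expR (v *
  (h (subsample X (fun j => s (block_index l j)) w) - mean)).
have n_fact : n`! = #|{perm 'I_n}| by rewrite card_Sn.
have nf_neq0 : n`!%:R != 0 :> R by rewrite pnatr_eq0 -lt0n fact_gt0.
have gE s w : g s w = expR (u * (k%:R^-1 * (\sum_(l < k)
    h [tuple X (s (block_index l j)) w | j < m]) - mean)).
  rewrite /g -expR_sum -mulr_sumr sumrB sumr_const card_ord.
  by rewrite -[mean *+ _]mulr_natl; congr expR; rewrite /v; field.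
have Ug w : expR (u * (U_statistic h (fun i => X i w) - mean)) <=
    n`!%:R^-1 * \sum_s g s w.
  rewrite (eq_bigr _ (fun s _ => gE s w)) n_fact.
  apply: le_trans (expR_mean_le _ _); last by rewrite -n_fact fact_gt0.
  rewrite -mulr_sumr mulrCA ler_expR ler_wpM2l// sumrB sumr_const.
  rewrite (U_statistic_blocks h (X ^~ w)) mulrBr -n_fact.
  by rewrite -[mean *+ _]mulr_natl mulKf.
have g_ge0 s w : 0 <= g s w by apply: prodr_ge0 => l _; exact: expR_ge0.
have mg s : measurable_fun [set: T] (g s).
  apply: measurable_prod => l _; apply: measurableT_comp => //.
  apply: measurable_funM => //; apply: measurable_funB => //.
  by apply: measurableT_comp => //; exact: measurable_subsample.
apply: (@le_trans _ _ (\int[P]_w (n`!%:R^-1 * \sum_s g s w)%:E)%E).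
  apply: ge0_le_integral => //.
  - apply/measurable_EFinP; apply: measurableT_comp => //.
    apply: measurable_funM => //; apply: measurable_funB => //.
    exact: measurable_U_statistic.
  - apply/measurable_EFinP; apply: measurable_funM => //.
    exact: measurable_sum.
  - by move=> w _; rewrite lee_fin.
under eq_integral do rewrite EFinM -sumEFin.
rewrite ge0_integralZl//; last 2 first.
- by apply: emeasurable_sum => s; exact/measurable_EFinP.
- by move=> w _; apply: sume_ge0 => s _; rewrite lee_fin.
rewrite ge0_integral_sum//; last 2 first.
- by move=> s; exact/measurable_EFinP.
- by move=> s w _; rewrite lee_fin.
set M := expR _.
apply: (@le_trans _ _ (n`!%:R^-1%:E * \sum_(s : {perm 'I_n}) M%:E)%E).
  apply: lee_wpmul2l; first by rewrite lee_fin.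
  apply: lee_sum => s _; have v_ge0 : 0 <= v by rewrite divr_ge0.
  apply: le_trans (block_mgf_le s v_ge0) _.
  rewrite lee_fin ler_expR le_eqVlt; apply/orP; left; apply/eqP.
  by rewrite /v; field.
rewrite sumEFin -EFinM sumr_const -n_fact -[M *+ _]mulr_natl.
by rewrite mulKf.
Qed.

Lemma U_statistic_tail_le (t : R) : 0 < t ->
  (P [set w : T | (t <= U_statistic h (fun i => X i w) - mean)%R] <=
     (expR (- (2 * k%:R * t ^+ 2 / (b - a) ^+ 2)))%:E)%E.
Proof.
move=> t_gt0; have ba_gt0 : 0 < b - a by rewrite subr_gt0.
have k_gt0R : 0 < k%:R :> R by rewrite ltr0n.
(* The minimiser of u ^+ 2 * (b - a) ^+ 2 / (8 * k%:R) - u * t. *)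
pose u := 4 * k%:R * t / (b - a) ^+ 2.
have u_gt0 : 0 < u by rewrite divr_gt0 ?exprn_gt0// !mulr_gt0.
pose Y (w : T) := U_statistic h (fun i => X i w) - mean.
have mY : measurable_fun [set: T] Y.
  by apply: measurable_funB => //; exact: measurable_U_statistic.
pose Ym : {mfun T >-> R} := HB.pack Y (isMeasurableFun.Build _ _ _ _ Y mY).
apply: (le_trans (chernoff (Ym : {RV P >-> R}) t u_gt0)).
have -> : ('M_P Ym u = \int[P]_w (expR (u * Y w))%:E)%E.
  rewrite /mmt_gen_fun unlock; apply: eq_integral => w _ /=.
  by rewrite mulrC.
apply: (@le_trans _ _ ((expR (u ^+ 2 * (b - a) ^+ 2 / (8 * k%:R)))%:E *
    (expR (- (u * t)))%:E)%E).
  apply: lee_wpmul2r; first by rewrite lee_fin expR_ge0.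
  exact: U_statistic_mgf_le (ltW u_gt0).
rewrite -EFinM -expRD lee_fin ler_expR le_eqVlt; apply/orP; left; apply/eqP.
by rewrite /u; field; rewrite !gt_eqF.
Qed.

End hoeffding_U.

Theorem theorem3p2 (R : realType) (d d' : measure_display)
    (T : measurableType d) (S : measurableType d') (P : probability T R)
    (m n : nat) (m_ge2 : (2 <= m)%N) (m_le_n : (m <= n)%N)
    (X : 'I_n -> {RV P >-> S}) (X_iid : iid X)
    (h : m.-tuple S -> R) (h_meas : measurable_fun [set: m.-tuple S] h)
    (a b len : R) (len_gt0 : 0 < len) (len_ab : b - a = len)
    (h_ab : forall x, a <= h x <= b)
    (t : R) (t_gt0 : 0 < t) :
  let k := (n %/ m)%N in
  let m_h :=
    fine 'E_P[fun w => h [tuple X (widen_ord m_le_n j) w | j < m]] in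
  let U := fun w : T => U_statistic h (fun i => X i w) in
  (P [set w : T | (t <= U w - m_h)%R] <=
     (expR (- (2 * k%:R * t ^+ 2 / len ^+ 2)))%:E)%E /\
  (P [set w : T | (t <= `|U w - m_h|)%R] <=
     (2 * expR (- (2 * k%:R * t ^+ 2 / len ^+ 2)))%:E)%E.
Proof.
move=> k m_h U.
have m_gt0 : (0 < m)%N by exact: ltn_trans m_ge2.
have ab : a < b by rewrite -subr_gt0 len_ab.
have upper : (P [set w : T | (t <= U w - m_h)%R] <=
     (expR (- (2 * k%:R * t ^+ 2 / len ^+ 2)))%:E)%E.
  by rewrite -len_ab; exact: U_statistic_tail_le.
split=> //.
(* The lower tail is the upper tail for - h, with values in [- b, - a]. *)
pose h' x := - h x.
have mh' : measurable_fun [set: m.-tuple S] h' by exact: measurableT_comp.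
have h'_ab x : - b <= h' x <= - a.
  by rewrite !lerN2 andbC; exact: h_ab.
have ab' : - b < - a by rewrite ltrN2.
have := U_statistic_tail_le m_gt0 m_le_n X_iid mh' h'_ab ab' t_gt0.
have -> : - a - - b = len by rewrite opprK addrC.
set m_h' := fine _.
have m_h'E : m_h' = - m_h.
  pose Z (w : T) := h [tuple X (widen_ord m_le_n j) w | j < m].
  have mZ : measurable_fun [set: T] Z.
    by apply: measurableT_comp => //; exact: measurable_subsample.
  have iZ := @bounded_integrable _ _ _ P Z a b mZ (fun w => h_ab _).
  rewrite /m_h' /m_h -fineN; congr fine; rewrite unlock -integralN.
    by apply: eq_integral.
  exact: integrable_add_def.
have U'E w : U_statistic h' (fun i => X i w) = - U w.
  by rewrite /U /U_statistic sumrN mulrN.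
move=> lower.
have mUm : measurable_fun [set: T] (fun w => U w - m_h).
  by apply: measurable_funB => //; exact: measurable_U_statistic.
have mset (V : T -> R) : measurable_fun [set: T] V ->
    measurable [set w | t <= V w].
  move=> mV.
  rewrite (_ : [set w | _] = V @^-1` `[t, +oo[).
    by rewrite -[X in measurable X]setTI; exact: mV.
  by apply/seteqP; split => w /=; rewrite in_itv /= andbT.
have m_up := mset _ mUm.
have m_low := mset (fun w => - (U w - m_h)) (measurableT_comp _ mUm).
rewrite mulr_natl mulr2n EFinD.
apply: (@le_trans _ _ (P ([set w | t <= U w - m_h] `|`
    [set w | t <= - (U w - m_h)]))).
  apply: le_measure; rewrite ?inE.
  - by apply: mset; exact: measurableT_comp.
  - by apply: measurableU => //; exact: m_low.
  - by move=> w /=; rewrite ler_normr => /orP.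
apply: le_trans (measureU2 P m_up (m_low _)) _ => //.
apply: leeD => //.
apply: le_trans lower; rewrite le_eqVlt; apply/orP; left; apply/eqP.
congr (P _); apply/seteqP; split => w /=;
  by rewrite U'E m_h'E opprB opprK addrC.
Qed.
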